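(* Let $\mathbf T=\{\mathbf t=(t_1,t_2)\in\mathbb R_+^2:0\le t_2\le t_1\}$ with the metric $m(\mathbf t,\mathbf s)=|t_1-s_1|\vee|t_2-s_2|$, and let $X=\{X(\mathbf t),\mathbf t\in\mathbf T\}$ satisfy conditions $(D_1)$–$(D_3)$ below with constants $\beta,\gamma,\delta>0$, $C(\beta,\gamma)$, $C(\delta)$. For $0\le a<b$ put $\mathbf T_{a,b}=\{\mathbf t\in\mathbf T: a\le t_1\le b\}$. Then for any $\theta\in(0,1)$, any $\lambda>0$ and any $\kappa$ with $0<\kappa<1\wedge 2\gamma$, $$E\exp\Big\{\lambda\sup_{\mathbf t\in\mathbf T_{a,b}}|X(\mathbf t)|\Big\}\le 2\widetilde Q(\lambda,\theta),\qquad \widetilde Q(\lambda,\theta)=\exp\Big\{\frac{\lambda^2(b^\delta C(\delta))^2}{2(1-\theta)^2}+\frac{2\lambda}{1-\theta}\,b^{\delta+\kappa_1}\frac{C_2}{\theta^{\kappa/(2\gamma)}\kappa^{1/2}}\Big\},$$ where $\kappa_1=\frac{\kappa}{2}\big(1+\frac{\beta}{\gamma}-\frac{\delta}{\gamma}\big)$ and $C_2=\frac{2^{(1-\kappa)/2}}{1-\frac{\kappa}{2\gamma}}\,C(\delta)^{1-\frac{\kappa}{2\gamma}}\,C(\beta,\gamma)^{\frac{\kappa}{2\gamma}}$.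
   Context: Conditions on a random process $X$ indexed by $\mathbf T$: $(D_1)$ $X$ is a centered Gaussian process on $\mathbf T$, separable on the metric space $(\mathbf T,m)$. $(D_2)$ There exist $\beta>0,\gamma>0$ and a constant $C(\beta,\gamma)$ such that for all $\mathbf t,\mathbf s\in\mathbf T$: $\big(E(X(\mathbf t)-X(\mathbf s))^2\big)^{1/2}\le C(\beta,\gamma)(t_1\vee s_1)^\beta\, m(\mathbf t,\mathbf s)^\gamma$. $(D_3)$ There exist $\delta>0$ and a constant $C(\delta)$ such that for all $\mathbf t\in\mathbf T$: $\big(E X(\mathbf t)^2\big)^{1/2}\le C(\delta)t_1^\delta$. *)

(* Defs.v *)
From HB Require Import structures.
From mathcomp Require Import all_boot all_order all_algebra.
From mathcomp Require Import all_classical all_reals all_analysis.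
Set Implicit Arguments. Unset Strict Implicit. Unset Printing Implicit Defensive.
Import Order.TTheory GRing.Theory Num.Theory.
Import numFieldNormedType.Exports.
Local Open Scope classical_set_scope.
Local Open Scope ring_scope.

Section defs.
Context {R : realType}.

Definition Tset : set (R * R) := [set t | 0 <= t.2 /\ t.2 <= t.1].

Definition mT (t s : R * R) : R := Num.max `|t.1 - s.1| `|t.2 - s.2|.

Definition Tab (a b : R) : set (R * R) := [set t | Tset t /\ a <= t.1 /\ t.1 <= b].

Context {d : measure_display} {Omega : measurableType d}.

Definition centered_gaussian (P : probability Omega R) (Y : Omega -> R) : Prop :=
  measurable_fun setT Y /\
  exists s : R, forall A : set R, measurable A ->
    P (Y @^-1` A) = if s == 0 then \d_(0:R) A else normal_prob 0 s A.

Definition centered_gaussian_process (P : probability Omega R)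
    (X : R * R -> Omega -> R) : Prop :=
  forall (n : nat) (ts : 'I_n -> R * R) (c : 'I_n -> R),
    (forall i, Tset (ts i)) ->
    centered_gaussian P (fun w => \sum_(i < n) c i * X (ts i) w).

(** (D1, second half) X is separable on (T, m) (Doob): there is a countable
    set S of T and a P-null set N such that for every w outside N and every
    t in T, (t, X(t,w)) is a limit of points (s_n, X(s_n,w)) with s_n in S. *)
Definition separable_process (P : probability Omega R)
    (X : R * R -> Omega -> R) : Prop :=
  exists S : set (R * R), countable S /\ S `<=` Tset /\
  exists N : set Omega, measurable N /\ P N = 0%E /\
    forall w, ~ N w -> forall t, Tset t ->
      exists u : nat -> R * R, (forall n, S (u n)) /\
        (fun n => mT (u n) t) @ \oo --> 0 /\
        (fun n => X (u n) w) @ \oo --> X t w.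

Definition Ex (P : probability Omega R) (Y : Omega -> R) : \bar R :=
  (\int[P]_w (Y w)%:E)%E.

End defs.

(* Main.v *)
(** Chaining with geometric radii.  Put [e0 = Cd b^delta], [eps_k = e0 theta^k] and
    let [h_k] be the mesh at which (D2) bounds increments by [eps_k].  A point of a
    finite family in [t.1 <= b] is reached from nets [F_0, F_1, ...] of mesh
    [h_1, h_2, ...], the first value having deviation [<= eps_0] and the k-th increment
    deviation [<= eps_k].  A maximum of [N <= exp (s^2/2)] normalized Gaussians [zeta]
    satisfies [E exp (mu (zeta - s)) <= 2 exp (mu^2/2)], so convexity of [exp] with
    weights [(1 - theta) theta^k] gives the bound with the entropy term
    [lambda \sum_k eps_k s_k]; here [s_k] comes from [ln (1 + x) <= x^kappa / kappa]
    and the series is geometric.  Fatou's lemma extends this to countable families and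
    separability to the supremum.  Separability approximates points with [t.1 = b] from
    [t.1 > b], and [Cbg], [Cd] may vanish, so the bound is first proved for
    [b + e, Cbg + e, Cd + e], and then [e] tends to [0]. *)
Require Import Defs.
From HB Require Import structures.
From mathcomp Require Import all_boot all_order all_algebra.
From mathcomp Require Import all_classical all_reals all_analysis.
From mathcomp Require Import measurable_realfun normal_distribution.
From mathcomp Require Import ring lra.
Import Order.TTheory GRing.Theory Num.Theory.
Import numFieldNormedType.Exports.
Local Open Scope classical_set_scope.
Local Open Scope ring_scope.

(** * Gaussian integrals and the variance parameter *)

(** The Radon-Nikodym derivative of [normal_prob m s] and [normal_pdf m s] have the same integral
    over every measurable set, hence agree almost everywhere. *)
Lemma ge0_integral_normal_prob (R : realType) (m s : R) (f : R -> \bar R) :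
  (forall x, (0 <= f x)%E) -> measurable_fun [set: R] f ->
  (\int[normal_prob m s]_x f x =
   \int[lebesgue_measure]_x (f x * (normal_pdf m s x)%:E))%E.
Proof.
move=> f0 mf; have dom := normal_prob_dominates m s.
rewrite -(Radon_Nikodym_SigmaFinite.change_of_variables dom)//.
apply: ae_eq_integral => //.
- apply: emeasurable_funM => //.
  exact: measurable_int (Radon_Nikodym_SigmaFinite.f_integrable dom).
- apply: emeasurable_funM => //; apply/measurable_EFinP.
  exact: measurable_normal_pdf.
- apply: ae_eqe_mul2l; apply: integral_ae_eq => //=.
  + exact: Radon_Nikodym_SigmaFinite.f_integrable.
  + by apply/measurable_EFinP; exact: measurable_normal_pdf.
  + by move=> E _ mE; rewrite -Radon_Nikodym_SigmaFinite.f_integral.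
Qed.

(** Reweighting the density by [f] yields [K] times another normal density, whose total mass is 1.
    The next two integrals follow by completing the square: a linear exponent shifts the mean, a
    quadratic one shrinks the deviation. *)
Lemma normal_prob_tilt (R : realType) (s m' s' K : R) (f : R -> R) :
  0 <= K -> (forall x, 0 <= f x) -> measurable_fun [set: R] f ->
  (forall x, f x * normal_pdf 0 s x = K * normal_pdf m' s' x) ->
  (\int[normal_prob 0 s]_x (f x)%:E = K%:E)%E.
Proof.
move=> K0 f0 mf fE; rewrite ge0_integral_normal_prob//; last exact/measurable_EFinP.
under eq_integral do rewrite -EFinM fE EFinM.
rewrite ge0_integralZl//; first by rewrite integral_normal_pdf mule1.
- by apply/measurable_EFinP; exact: measurable_normal_pdf.
- by move=> x _; rewrite lee_fin normal_pdf_ge0.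
Qed.

Lemma normal_prob_mgf (R : realType) (s c : R) : s != 0 ->
  (\int[normal_prob 0 s]_x (expR (c * x))%:E = (expR (c ^+ 2 * s ^+ 2 / 2))%:E)%E.
Proof.
move=> s0; apply: (@normal_prob_tilt _ _ (c * s ^+ 2) s) => //.
- by apply: measurableT_comp => //; exact: measurable_funM.
- move=> x; rewrite !normal_pdfE// mulrCA [RHS]mulrCA; congr (_ * _).
  by rewrite /normal_fun -!expRD; congr expR; field.
Qed.

Lemma normal_prob_expRN_sqr (R : realType) (s c : R) : s != 0 -> 0 < c ->
  (\int[normal_prob 0 s]_x (expR (- (c * x ^+ 2)))%:E =
   (Num.sqrt (1 + 2 * c * s ^+ 2))^-1%:E)%E.
Proof.
move=> s0 c0; set k := Num.sqrt _.
have s20 : 0 < s ^+ 2 by rewrite exprn_even_gt0.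
have d0 : 0 < 1 + 2 * c * s ^+ 2 by have := mulr_gt0 c0 s20; lra.
have k0 : 0 < k by rewrite sqrtr_gt0.
have k2 : k ^+ 2 = 1 + 2 * c * s ^+ 2 by rewrite sqr_sqrtr// ltW.
apply: (@normal_prob_tilt _ _ 0 (s / k)).
- by rewrite invr_ge0 ltW.
- by [].
- apply: measurableT_comp => //; apply: measurableT_comp => //.
  by apply: measurable_funM => //; exact: measurable_funX.
- move=> x; rewrite !normal_pdfE ?mulf_neq0 ?invr_eq0 ?(gt_eqF k0)//.
  have -> : normal_peak (s / k) = k * normal_peak s.
    rewrite /normal_peak expr_div_n.
    have -> : s ^+ 2 * pi *+ 2 = (s ^+ 2 / k ^+ 2 * pi *+ 2) * k ^+ 2.
      by field; rewrite gt_eqF.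
    rewrite [in RHS]sqrtrM; last first.
      by rewrite mulrn_wge0// mulr_ge0 ?pi_ge0// divr_ge0// sqr_ge0.
    by rewrite sqrtr_sqr gtr0_norm//; set q := Num.sqrt _;
      rewrite (mulrC q) invfM mulVKf ?gt_eqF.
  rewrite -[k * _ * _]mulrA mulKf ?gt_eqF// mulrCA; congr (_ * _).
  rewrite /normal_fun -expRD; congr expR; rewrite expr_div_n k2.
  by field; rewrite s0 gt_eqF.
Qed.

(** To first order in [c] the right-hand side of the hypothesis is [1 - c S + c v], so [v < S] is
    refuted by a small enough [c]. *)
Lemma ler_of_expRN_sqr_moment (R : realType) (S v : R) : 0 <= S -> 0 <= v ->
  (forall c, 0 < c -> 1 <= (Num.sqrt (1 + 2 * c * S))^-1 + c * v) -> S <= v.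
Proof.
move=> S0 v0 H; rewrite leNgt; apply/negP => vS.
have Sp : 0 < S by exact: le_lt_trans vS.
(* With this [c], [2 c S v = (S - v) v / (2 S) < S - v]. This makes [(1 - 2 c v) (1 + 2 c S)] exceed
   1, against the squared hypothesis. *)
pose c := (S - v) / (4 * S ^+ 2).
have c0 : 0 < c by rewrite divr_gt0 ?subr_gt0// mulr_gt0// exprn_gt0.
have cS : c * S * 4 = (S - v) / S by rewrite /c; field; rewrite gt_eqF.
have q1 : (S - v) / S <= 1 by rewrite ler_pdivrMr// mul1r lerBlDr lerDl.
have cv1 : c * v <= c * S by rewrite ler_pM2l// ltW.
have d0 : 0 < 1 + 2 * c * S by have := mulr_gt0 c0 Sp; lra.
have := H c c0; set k := Num.sqrt _ => Hc.
have k0 : 0 < k by rewrite sqrtr_gt0.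
have k2 : k ^+ 2 = 1 + 2 * c * S by rewrite sqr_sqrtr// ltW.
have A : (1 - c * v) * k <= 1.
  by rewrite -ler_pdivlMr// mul1r lerBlDr.
have cvS : 2 * (c * S) * v < S - v.
  have -> : 2 * (c * S) * v = (S - v) * (v / S / 2).
    by rewrite /c; field; rewrite gt_eqF.
  rewrite gtr_pMr ?subr_gt0// -mulrA -[X in X < _]mulr1.
  have : v / S <= 1 by rewrite ler_pdivrMr// mul1r ltW.
  lra.
have : ((1 - c * v) * k) ^+ 2 <= 1.
  by rewrite expr_le1// mulr_ge0 ?(ltW k0)// subr_ge0; lra.
rewrite exprMn k2; apply/negP; rewrite -ltNge.
have h1 : 1 - 2 * (c * v) <= (1 - c * v) ^+ 2.
  by have := sqr_ge0 (c * v); rewrite expr2; nra.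
apply: lt_le_trans (_ : (1 - 2 * (c * v)) * (1 + 2 * c * S) <= _); last first.
  by rewrite ler_pM2r.
have : 0 < c * (S - v - 2 * (c * S) * v) by rewrite mulr_gt0// subr_gt0.
nra.
Qed.

(** * Exponential moments of centered Gaussian variables *)

Section centered_gaussian.
Context {R : realType} {d : measure_display} {Omega : measurableType d}.
Variable P : probability Omega R.
Implicit Type Y : Omega -> R.

Lemma centered_gaussianP Y : centered_gaussian P Y -> measurable_fun setT Y /\
  exists s : R, forall f : R -> \bar R,
    (forall x, (0 <= f x)%E) -> measurable_fun setT f ->
    (\int[P]_w f (Y w) =
     if s == 0%R then f 0%R else \int[normal_prob 0 s]_x f x)%E.
Proof.
move=> [mY [s Ys]]; split=> //; exists s => f f0 mf.
(* [normal_prob] and [\d_0] live on two presentations of the Borel sets. *)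
have [s0|s0] := eqVneq s 0.
  rewrite -[LHS](@ge0_integral_pushforward _ _ _ _ _ _ mY P setT)//.
  transitivity (\int[\d_(0%R : R)]_x f x)%E.
    apply: eq_measure_integral => A mA _.
    by have := Ys A mA; rewrite s0 eqxx.
  by rewrite integral_dirac// diracT mul1e.
have mY' : @measurable_fun _ _ Omega (measurableTypeR R) setT Y := mY.
have mf' : @measurable_fun _ _ (measurableTypeR R) _ setT f := mf.
rewrite -[LHS](@ge0_integral_pushforward _ _ _ _ _ _ mY' P setT)//.
apply: eq_measure_integral => A mA _; have := Ys A mA.
by rewrite (negbTE s0).
Qed.

(* [1 - exp (- c y^2) <= c y^2], divided by [c] as [c] tends to [0], bounds the
   variance parameter by the second moment. *)
Lemma centered_gaussian_mgf Y : centered_gaussian P Y -> exists s : R,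
  (forall c, \int[P]_w (expR (c * Y w))%:E = (expR (c ^+ 2 * s ^+ 2 / 2))%:E)%E
  /\ ((Ex P (fun w => (Y w ^+ 2)%R) < +oo)%E ->
      s ^+ 2 <= fine (Ex P (fun w => (Y w ^+ 2)%R))).
Proof.
move=> /centered_gaussianP[mY [s Ys]]; exists s; split.
  move=> c; rewrite (Ys (fun x => (expR (c * x))%:E))//; last first.
    by apply/measurable_EFinP; apply: measurableT_comp => //; exact: measurable_funM.
  case: eqP => [->|/eqP s0]; last by rewrite normal_prob_mgf.
  by rewrite mulr0 expr0n/= mulr0 mul0r expR0.
set V := Ex _ _ => Voo.
have V0 : (0 <= V)%E by apply: integral_ge0 => w _; rewrite lee_fin sqr_ge0.
have Vf : V \is a fin_num by rewrite ge0_fin_numE.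
apply: ler_of_expRN_sqr_moment; [exact: sqr_ge0|exact: fine_ge0|move=> c c0].
have mE : measurable_fun setT (fun x : R => (expR (- (c * x ^+ 2)))%:E).
  apply/measurable_EFinP; apply: measurableT_comp => //; apply: measurableT_comp => //.
  by apply: measurable_funM => //; exact: measurable_funX.
have EE : (\int[P]_w (expR (- (c * Y w ^+ 2)))%:E =
           (Num.sqrt (1 + 2 * c * s ^+ 2))^-1%:E)%E.
  rewrite (Ys (fun x => (expR (- (c * x ^+ 2)))%:E))//.
  case: eqP => [->|/eqP s0]; last by rewrite normal_prob_expRN_sqr.
  by rewrite expr0n/= !mulr0 oppr0 expR0 addr0 sqrtr1 invr1.
have mY2 : measurable_fun setT (fun w => (Y w ^+ 2)%:E).
  by apply/measurable_EFinP; exact: measurable_funX.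
rewrite -lee_fin EFinD EFinM fineK// -EE /V /Ex -ge0_integralZl//; first last.
- by rewrite lee_fin ltW.
- by move=> w _; rewrite lee_fin sqr_ge0.
rewrite -ge0_integralD//; first last.
- by apply: emeasurable_funM => //.
- by move=> w _; rewrite mule_ge0// lee_fin ?sqr_ge0// ltW.
- exact: (measurableT_comp mE).
rewrite -[leLHS](@probability_setT _ _ _ P) -[leLHS]mul1e -integral_cst//.
apply: ge0_le_integral => //.
- apply: emeasurable_funD; first exact: (measurableT_comp mE).
  exact: emeasurable_funM.
- move=> w _; rewrite -EFinM -EFinD lee_fin -lerBlDr.
  exact: expR_ge1Dx.
Qed.

(** Since [exp (c |y|) <= exp (c y) + exp (- c y)], two copies of the moment generating function
    suffice, and its variance parameter is at most [sigma ^+ 2]. *)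
Lemma centered_gaussian_exp_norm Y (sigma : R) : centered_gaussian P Y ->
  (Ex P (fun w => (Y w ^+ 2)%R) < +oo)%E ->
  Num.sqrt (fine (Ex P (fun w => (Y w ^+ 2)%R))) <= sigma ->
  forall c : R, (\int[P]_w (expR (c * `|Y w|))%:E <=
                 (2 * expR (c ^+ 2 * sigma ^+ 2 / 2))%:E)%E.
Proof.
move=> gY Voo Vs c; have [s [mgf /(_ Voo) sV]] := centered_gaussian_mgf _ gY.
have mY := gY.1.
have me e : measurable_fun setT (fun w => (expR (e * Y w))%:E).
  by apply/measurable_EFinP; apply: measurableT_comp => //; exact: measurable_funM.
have ss : s ^+ 2 <= sigma ^+ 2.
  have v0 : 0 <= fine (Ex P (fun w => (Y w ^+ 2)%R)) by exact: le_trans (sqr_ge0 s) sV.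
  rewrite (le_trans sV)// -[leLHS](sqr_sqrtr v0) ler_sqr// nnegrE//.
  exact: le_trans (sqrtr_ge0 _) Vs.
apply: (@le_trans _ _ (\int[P]_w ((expR (c * Y w))%:E + (expR ((- c) * Y w))%:E))%E).
  apply: ge0_le_integral => //.
  - apply/measurable_EFinP; apply: measurableT_comp => //.
    by apply: measurable_funM => //; exact: measurableT_comp.
  - exact: emeasurable_funD.
  - move=> w _; rewrite -EFinD lee_fin; case: (ger0P (Y w)) => _.
      by rewrite lerDl expR_ge0.
    by rewrite mulrN mulNr lerDr expR_ge0.
rewrite ge0_integralD// !mgf sqrrN -EFinD lee_fin -mulr2n mulr_natl lerMn2r/=.
by rewrite ler_expR ler_pM2r// ler_wpM2l// sqr_ge0.
Qed.

End centered_gaussian.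

(** * Elementary inequalities *)

(** Jensen's inequality with the missing weight placed at the point 0, proved from the tangent line
    of [expR] at the weighted mean [m]. *)
Lemma expR_subconvex (R : realType) (n : nat) (w y : 'I_n -> R) :
  (forall i, 0 <= w i) -> \sum_i w i <= 1 ->
  expR (\sum_i w i * y i) <= \sum_i w i * expR (y i) + (1 - \sum_i w i).
Proof.
move=> w0 w1; set m := \sum_i w i * y i.
have tangent x : expR m * (1 + (x - m)) <= expR x.
  by rewrite -[X in _ <= expR X](subrKC m) expRD ler_wpM2l ?expR_ge0// expR_ge1Dx.
have -> : expR m = \sum_i w i * (expR m * (1 + (y i - m))) +
    (1 - \sum_i w i) * (expR m * (1 + (0 - m))).
  have E i : w i * (expR m * (1 + (y i - m))) =
      expR m * (w i * y i) + w i * (expR m * (1 - m)) by ring.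
  by rewrite (eq_bigr _ (fun i _ => E i)) big_split/= -mulr_sumr -mulr_suml -/m; ring.
rewrite lerD//.
  by apply: ler_sum => i _; rewrite ler_wpM2l.
by rewrite -[leRHS]mulr1 ler_wpM2l ?subr_ge0// -[leRHS]expR0.
Qed.

(** Subadditivity [(1 + x)^kappa <= 1 + x^kappa] gives [kappa ln (1 + x) <= ln (1 + x^kappa) <=
    x^kappa]. Subadditivity itself comes from [z <= z^kappa] on [0, 1], applied to [1 / (1 + x)] and
    [x / (1 + x)], which add up to 1. *)
Lemma expR_ge_1Dx_powR (R : realType) (kappa x : R) :
  0 < kappa -> kappa <= 1 -> 0 <= x -> 1 + x <= expR (x `^ kappa / kappa).
Proof.
move=> k0 k1 x0; have y0 : 0 < 1 + x by rewrite ltr_wpDr.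
have sub : (1 + x) `^ kappa <= 1 + x `^ kappa.
  have le_powR z : 0 <= z -> z <= 1 -> z <= z `^ kappa.
    rewrite le_eqVlt => /predU1P[<- _|z0 z1]; first exact: powR_ge0.
    rewrite -[leLHS]lnK// /powR gt_eqF// ler_expR.
    by rewrite -[leLHS]mul1r ler_wnM2r// ln_le0.
  have := lerD (le_powR (1 + x)^-1 _ _) (le_powR (x / (1 + x)) _ _).
  rewrite invr_ge0 (ltW y0) invf_le1// lerDl x0 divr_ge0 ?(ltW y0)//.
  rewrite ler_pdivrMr// mul1r lerDr ler01 => /(_ erefl erefl erefl erefl).
  rewrite -{1}[(1 + x)^-1]mul1r -mulrDl divff ?gt_eqF//.
  have -> : (1 + x)^-1 `^ kappa = ((1 + x) `^ kappa)^-1.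
    by rewrite -(powR_inv1 (ltW y0)) -powRrM mulN1r powRN.
  rewrite powRM ?invr_ge0 ?(ltW y0)// -(powR_inv1 (ltW y0)) -powRrM mulN1r powRN.
  by rewrite -[X in X + _]mul1r -mulrDl ler_pdivlMr ?powR_gt0// mul1r.
rewrite -[leLHS]lnK// ler_expR ler_pdivlMr// mulrC -ln_powR.
by rewrite -ler_expR lnK ?posrE ?powR_gt0// (le_trans sub)// expR_ge1Dx.
Qed.

Lemma sum_geometric_le (R : realType) (q : R) (n : nat) : 0 <= q -> q < 1 ->
  \sum_(k < n) q ^+ k <= (1 - q)^-1.
Proof.
move=> q0 q1; have := subrX1 q n.
rewrite -div1r ler_pdivlMr ?subr_gt0// => e.
have := exprn_ge0 n q0; nra.
Qed.

(** * Finite nets for the metric [mT] *)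

Lemma class_representatives (T U : eqType) (c : T -> U) (F : seq T) :
  exists (F' : seq T) (p : T -> T), [/\ {subset F' <= F}, uniq (map c F') &
    forall t, t \in F -> p t \in F' /\ c (p t) = c t].
Proof.
pose p t := nth t F (index (c t) (map c F)).
have ltF t : t \in F -> (index (c t) (map c F) < size F)%N.
  by move=> tF; rewrite -(size_map c) index_mem map_f.
have cp t : t \in F -> c (p t) = c t.
  by move=> tF; rewrite -(nth_map _ (c t)) ?ltF// nth_index// map_f.
exists (undup (map p F)), p; split.
- by move=> u; rewrite mem_undup => /mapP[t tF ->]; rewrite mem_nth// ltF.
- rewrite map_inj_in_uniq ?undup_uniq// => u v.
  rewrite !mem_undup => /mapP[t tF ->] /mapP[t' t'F ->].
  by rewrite !cp// /p => <-; apply: set_nth_default; exact: ltF.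
- by move=> t tF; rewrite mem_undup map_f// cp.
Qed.

Lemma dist_same_trunc (R : realType) (h x y : R) : 0 < h -> 0 <= x -> 0 <= y ->
  Num.trunc (x / h) = Num.trunc (y / h) -> `|x - y| <= h.
Proof.
move=> h0 x0 y0 e.
have := truncn_itv (divr_ge0 x0 (ltW h0)); rewrite e => /andP[a1 a2].
have /andP[b1 b2] := truncn_itv (divr_ge0 y0 (ltW h0)).
rewrite -[leRHS]mul1r -ler_pdivrMr// -[X in _ / X](gtr0_norm h0) -normf_div mulrBl.
rewrite -natr1 in a2 b2; rewrite ler_norml; apply/andP; split; lra.
Qed.

(** Cut the plane into squares of side [h] and keep one point of [F] from each occupied square; each
    axis meets at most [1 + b / h] cells. Choosing the net inside [F] keeps it in [Tset], where the
    increment bound applies. *)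
Lemma grid_net (R : realType) (b h : R) (F : seq (R * R)) : 0 <= b -> 0 < h ->
  (forall t, t \in F -> Tset t /\ t.1 <= b) ->
  exists (F' : seq (R * R)) (p : R * R -> R * R), [/\ {subset F' <= F},
    (size F')%:R <= (1 + b / h) ^+ 2 &
    forall t, t \in F -> p t \in F' /\ mT t (p t) <= h].
Proof.
move=> b0 h0 FT; pose c (t : R * R) := (Num.trunc (t.1 / h), Num.trunc (t.2 / h)).
have [F' [p [sF' uF' Fp]]] := class_representatives _ _ c F.
exists F', p; split=> //.
- pose N := (Num.trunc (b / h)).+1.
  have bh : 0 <= b / h by rewrite divr_ge0// ltW.
  have : (size (map c F') <= size [seq (i, j) | i <- iota 0 N, j <- iota 0 N])%N.
    apply: uniq_leq_size => // _ /mapP[t /sF'/FT[[t20 t21] tb] ->].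
    by apply/allpairsP; exists (c t); split; rewrite // mem_iota/= ltnS;
      apply: le_truncn; rewrite ler_pM2r ?invr_gt0//; exact: le_trans tb.
  rewrite size_map size_allpairs size_iota -(ler_nat R) => /le_trans; apply.
  rewrite natrM -expr2 lerXn2r ?nnegrE ?addr_ge0//.
  by rewrite /N -add1n natrD lerD2l; have /andP[] := truncn_itv bh.
- move=> t tF; have [pF' [e1 e2]] := Fp _ tF; split=> //.
  have [[t20 t21] _] := FT _ tF; have [[s20 s21] _] := FT _ (sF' _ pF').
  rewrite /mT ge_max; apply/andP; split; apply: dist_same_trunc => //.
    exact: le_trans t21.
  exact: le_trans s21.
Qed.

(** * Maximal inequality and chaining *)

Section chaining.
Context {R : realType} {d : measure_display} {Omega : measurableType d}.
Variable P : probability Omega R.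

(** A sub-Gaussian condition on the absolute value of [Y], with the factor 2 for the two tails. The
    two bounds of this section use the variables only through it. *)
Definition exp_norm_bounded (Y : Omega -> R) (sigma : R) :=
  measurable_fun setT Y /\ forall c : R,
    (\int[P]_w (expR (c * `|Y w|))%:E <= (2 * expR (c ^+ 2 * sigma ^+ 2 / 2))%:E)%E.

Lemma probability_integral_cst (c : R) : (\int[P]_w c%:E = c%:E)%E.
Proof.
by rewrite -[RHS]mule1 -(@probability_setT _ _ _ P) -integral_cst.
Qed.

(** A union bound: the sum [S c] of [exp (c |Y t| / sigma)] over [l] has expectation at most
    [2 exp (s^2/2 + c^2/2)]. For [s <= mu], take [c = mu]; the factor [exp (- mu s)] then absorbs
    [exp (s^2/2)]. *)
Lemma max_exp_bound (T : eqType) (Y : T -> Omega -> R) (l : seq T) (sigma s mu : R) :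
  0 < sigma -> 0 <= s -> 0 < mu -> (size l)%:R <= expR (s ^+ 2 / 2) ->
  (forall t, t \in l -> exp_norm_bounded (Y t) sigma) ->
  exists g : Omega -> R, [/\ measurable_fun setT g,
    forall t w, t \in l -> `|Y t w| <= sigma * g w &
    (\int[P]_w (expR (mu * (g w - s)))%:E <= (2 * expR (mu ^+ 2 / 2))%:E)%E].
Proof.
move=> sigma0 s0 mu0 ls lY.
have exp1 : 1 <= expR (mu ^+ 2 / 2).
  by rewrite -[leLHS]expR0 ler_expR divr_ge0// sqr_ge0.
(* It is enough to dominate the exponentials by a positive [G]: solving [exp (mu (g - s)) = G] for
   [g] gives the envelope. *)
suff [G [mG G0 lG IG]] : exists G : Omega -> R, [/\ measurable_fun setT G,
    forall w, 0 < G w,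
    forall t w, t \in l -> expR (mu * (`|Y t w| / sigma - s)) <= G w &
    (\int[P]_w (G w)%:E <= (2 * expR (mu ^+ 2 / 2))%:E)%E].
  exists (fun w => s + ln (G w) / mu); split.
  - apply: measurable_funD => //; apply: measurable_funM => //.
    exact: measurableT_comp.
  - move=> t w /lG-/(_ w); rewrite -ler_ln ?posrE ?expR_gt0// expRK => H.
    by rewrite mulrC -ler_pdivrMr// addrC -lerBlDr ler_pdivlMr// mulrC.
  - rewrite (eq_integral (fun w => (G w)%:E))// => w _; congr EFin.
    by rewrite addrAC subrr add0r mulrC divfK ?gt_eqF// lnK ?posrE.
(* The empty family is set apart because the sum [S] would vanish there, while [G] has to be
   positive. *)
have [->|[t0 t0l]] : l = [::] \/ exists t, t \in l.
- by case: (l) => [|t ?]; [left|right; exists t; rewrite inE eqxx].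
- exists (cst 1); split => //.
  by rewrite probability_integral_cst lee_fin; lra.
pose S c w := \sum_(t <- l) expR (c / sigma * `|Y t w|).
have mexp c t : t \in l -> measurable_fun setT (fun w => expR (c / sigma * `|Y t w|)).
  move=> tl; apply: measurableT_comp => //; apply: measurable_funM => //.
  by apply: measurableT_comp => //; exact: (lY _ tl).1.
have mS c : measurable_fun setT (S c).
  rewrite /S; under eq_fun do rewrite big_tnth.
  by apply: measurable_sum => i; apply: mexp; exact: mem_tnth.
have Sge c w t : t \in l -> expR (c / sigma * `|Y t w|) <= S c w.
  move=> tl; rewrite /S (big_rem t)//= lerDl.
  by apply: sumr_ge0 => u _; exact: expR_ge0.
have S0 c w : 0 < S c w by apply: lt_le_trans (Sge c w t0 t0l); exact: expR_gt0.
have IS c : (\int[P]_w (S c w)%:E <= (2 * expR (s ^+ 2 / 2 + c ^+ 2 / 2))%:E)%E.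
  under eq_integral do rewrite /S -sumEFin big_tnth.
  rewrite ge0_integral_sum//=; last first.
  - by move=> i; apply/measurable_EFinP/mexp; exact: mem_tnth.
  rewrite -(big_tnth _ _ l xpredT (fun t => \int[P]_w (expR (c / sigma * `|Y t w|))%:E)%E).
  apply: (@le_trans _ _ (\sum_(t <- l) (2 * expR (c ^+ 2 / 2))%:E)%E).
    rewrite big_seq [leRHS]big_seq; apply: lee_sum => t tl.
    apply: le_trans ((lY _ tl).2 _) _; rewrite lee_fin expr_div_n mulfVK//.
    by rewrite expf_neq0// gt_eqF.
  rewrite sumEFin lee_fin big_const_seq count_predT iter_addr_0 -[leLHS]mulr_natr.
  by rewrite expRD -mulrA ler_pM2l// mulrC ler_wpM2r ?expR_ge0.
have mGS c r : measurable_fun setT (fun w => r * S c w) by exact: measurable_funM.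
have IGS c r : 0 <= r -> (\int[P]_w (r * S c w)%:E <=
    (2 * (r * expR (s ^+ 2 / 2 + c ^+ 2 / 2)))%:E)%E.
  move=> r0; under eq_integral do rewrite EFinM.
  rewrite ge0_integralZl//; first last.
  - by move=> w _; rewrite lee_fin ltW.
  - exact/measurable_EFinP.
  by rewrite mulrCA EFinM lee_wpmul2l// lee_fin.
have [smu|mus] := leP s mu.
  exists (fun w => expR (- (mu * s)) * S mu w); split=> //.
  - by move=> w; rewrite mulr_gt0 ?expR_gt0.
  - move=> t w tl; rewrite mulrBr addrC expRD ler_wpM2l ?expR_ge0//.
    by rewrite mulrCA mulrC (le_trans _ (Sge _ _ _ tl)).
  - apply: le_trans (IGS _ _ (expR_ge0 _)) _.
    by rewrite lee_fin ler_pM2l// -expRD ler_expR; nra.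
(* For [mu < s], interpolate between the exponents [0] and [s]. *)
pose r := mu / s; have s0' : 0 < s by exact: lt_trans mus.
have r0 : 0 < r by rewrite divr_gt0.
have r1 : r < 1 by rewrite ltr_pdivrMr// mul1r.
exists (fun w => r * expR (- (s ^+ 2)) * S s w + (1 - r)); split=> //.
- exact: measurable_funD.
- by move=> w; rewrite addr_gt0 ?subr_gt0// mulr_gt0// mulr_gt0 ?expR_gt0.
- move=> t w tl; pose y := s * (`|Y t w| / sigma - s).
  have -> : mu * (`|Y t w| / sigma - s) = r * y.
    by rewrite /y mulrA divfK ?gt_eqF.
  have := @expR_subconvex _ 1 (fun=> r) (fun=> y).
  rewrite !big_ord1 => /(_ (fun=> ltW r0) (ltW r1))/le_trans; apply.
  rewrite lerD2r -mulrA ler_pM2l// /y mulrBr addrC expRD -expr2.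
  by rewrite ler_wpM2l ?expR_ge0// mulrCA mulrC (le_trans _ (Sge _ _ _ tl)).
- under eq_integral do rewrite EFinD.
  rewrite ge0_integralD//; first last.
  + by move=> w _; rewrite lee_fin subr_ge0 ltW.
  + exact/measurable_EFinP.
  + by move=> w _; rewrite lee_fin mulr_ge0 ?(ltW (S0 _ _))// mulr_ge0 ?expR_ge0 ?(ltW r0).
  rewrite probability_integral_cst.
  apply: (@le_trans _ _ ((2 * r)%:E + (1 - r)%:E)%E).
    rewrite leeD2r//; apply: le_trans (IGS _ _ _) _.
      by rewrite mulr_ge0 ?expR_ge0 ?(ltW r0).
    rewrite lee_fin -mulrA -expRD -splitr addNr.
    by rewrite expR0 mulr1.
  by rewrite -EFinD lee_fin; lra.
Qed.

(** [Z t] telescopes along the ancestors of [t], and the k-th link is at most [eps k * g k] with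
    [g k] independent of [t]. Convexity then separates the levels, so no joint law of the links
    enters. *)
Lemma chaining_exp_bound (T : eqType) (Z : T -> Omega -> R) (m : nat)
    (F : nat -> seq T) (par : nat -> T -> T) (eps s : nat -> R) (A lambda : R) :
  0 < A -> 0 < lambda -> (forall k, 0 < eps k) -> (forall k, 0 <= s k) ->
  \sum_(k < m.+1) eps k <= A ->
  (forall k, (k <= m)%N -> (size (F k))%:R <= expR (s k ^+ 2 / 2)) ->
  (forall t, t \in F 0 -> exp_norm_bounded (Z t) (eps 0)) ->
  (forall k t, (k < m)%N -> t \in F k.+1 -> par k t \in F k /\
     exp_norm_bounded (fun w => Z t w - Z (par k t) w) (eps k.+1)) ->
  exists G : Omega -> R, [/\ measurable_fun setT G, forall w, 0 <= G w,
    (\int[P]_w (G w)%:E <= (2 * expR ((lambda * A) ^+ 2 / 2))%:E)%E &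
    forall t w, t \in F m ->
      expR (lambda * `|Z t w|) <= expR (lambda * \sum_(k < m.+1) eps k * s k) * G w].
Proof.
move=> A0 l0 eps0 s0 epsA Fs F0 FS; set mu := lambda * A.
have mu0 : 0 < mu by rewrite mulr_gt0.
pose D k t w := if k is j.+1 then Z t w - Z (par j t) w else Z t w.
have gP k : exists g : Omega -> R, (k <= m)%N -> [/\ measurable_fun setT g,
    forall t w, t \in F k -> `|D k t w| <= eps k * g w &
    (\int[P]_w (expR (mu * (g w - s k)))%:E <= (2 * expR (mu ^+ 2 / 2))%:E)%E].
  (* Nothing is required beyond level [m]; a constant stands in there so that [choice] yields a
     whole sequence. *)
  have [km|] := leqP k m; last by exists (cst 0).
  have [t tF|g gP] := @max_exp_bound _ (D k) (F k) (eps k) (s k) mu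
    (eps0 k) (s0 k) mu0 (Fs k km).
  - by case: k km tF => [|k] km tF; [exact: F0|exact: (FS _ _ km tF).2].
  - by exists g.
have [g {}gP] := choice gP.
have Zg w k t : (k <= m)%N -> t \in F k -> `|Z t w| <= \sum_(j < k.+1) eps j * g j w.
  elim: k t => [|k IH] t km tF.
    by rewrite big_ord1; have [_ /(_ t w tF)] := gP 0%N km.
  rewrite big_ord_recr/=; have [pF _] := FS _ _ km tF.
  rewrite -(subrK (Z (par k t) w) (Z t w)) addrC (le_trans (ler_normD _ _))//.
  by rewrite lerD ?IH ?(ltnW km)//; have [_ /(_ t w tF)] := gP _ km.
(* These weights satisfy [wt k * mu = lambda * eps k], so the weighted exponents rebuild the
   chaining sum; the defect [1 - \sum wt] is the weight of the exponent 0. *)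
pose wt k := eps k / A.
have wt0 k : 0 < wt k by rewrite divr_gt0.
have wt1 : \sum_(k < m.+1) wt k <= 1.
  by rewrite /wt -mulr_suml ler_pdivrMr// mul1r.
pose e (k : 'I_m.+1) w := expR (mu * (g k w - s k)).
have me k : measurable_fun setT (e k).
  have [mg _ _] := gP k (ltn_ord k).
  apply: measurableT_comp => //; apply: measurable_funM => //.
  exact: measurable_funB.
exists (fun w => \sum_(k < m.+1) wt k * e k w + (1 - \sum_(k < m.+1) wt k)).
split.
- apply: measurable_funD => //; apply: measurable_sum => k.
  exact: measurable_funM.
- move=> w; rewrite addr_ge0 ?subr_ge0//.
  by apply: sumr_ge0 => k _; rewrite mulr_ge0 ?expR_ge0// ltW.
- under eq_integral do rewrite EFinD -sumEFin.
  rewrite ge0_integralD//; first last.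
  + by move=> w _; rewrite lee_fin subr_ge0.
  + apply: emeasurable_sum => k; apply/measurable_EFinP.
    exact: measurable_funM.
  + by move=> w _; apply: sume_ge0 => k _; rewrite lee_fin mulr_ge0 ?expR_ge0// ltW.
  rewrite probability_integral_cst ge0_integral_sum//; last 2 first.
  + by move=> k; apply/measurable_EFinP; exact: measurable_funM.
  + by move=> k w _; rewrite lee_fin mulr_ge0 ?expR_ge0// ltW.
  set C := 2 * _.
  apply: (@le_trans _ _ (\sum_(k < m.+1) (wt k * C)%:E + (1 - \sum_(k < m.+1) wt k)%:E)%E).
    rewrite leeD2r//; apply: lee_sum => k _.
    under eq_integral do rewrite EFinM.
    rewrite ge0_integralZl//; first last.
    * by rewrite lee_fin ltW.
    * by move=> w _; rewrite lee_fin expR_ge0.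
    * exact/measurable_EFinP.
    rewrite [leRHS]EFinM; apply: lee_wpmul2l; first by rewrite lee_fin ltW.
    by have [_ _] := gP k (ltn_ord k).
  rewrite sumEFin -EFinD lee_fin -mulr_suml.
  (* As [C] is at least 1, the left-over weight may be charged [C] as well. *)
  have C1 : 1 <= C.
    have : 1 <= expR (mu ^+ 2 / 2) by rewrite -[leLHS]expR0 ler_expR divr_ge0// sqr_ge0.
    by rewrite /C; lra.
  set W := \sum_(k < m.+1) wt k in wt1 *; rewrite -subr_ge0.
  have -> : C - (W * C + (1 - W)) = (1 - W) * (C - 1) by ring.
  by rewrite mulr_ge0 ?subr_ge0.
- move=> t w tF.
  have := @expR_subconvex _ m.+1 (fun k => wt k)
    (fun k => mu * (g k w - s k)) (fun k => ltW (wt0 k)) wt1.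
  move=> /(ler_wpM2l (expR_ge0 (lambda * \sum_(k < m.+1) eps k * s k))).
  apply: le_trans; rewrite -expRD ler_expR.
  have -> : \sum_(i < m.+1) wt i * (mu * (g i w - s i)) =
      \sum_(i < m.+1) lambda * (eps i * g i w) - \sum_(i < m.+1) lambda * (eps i * s i).
    rewrite -sumrB; apply: eq_bigr => i _; rewrite /wt /mu.
    by field; rewrite gt_eqF.
  by rewrite mulr_sumr subrKC -mulr_sumr ler_wpM2l ?(ltW l0)// Zg.
Qed.

End chaining.

(** * The entropy series for geometric radii *)

Lemma powR_expR (R : realType) (x p : R) : 0 < x -> x `^ p = expR (p * ln x).
Proof. by move=> x0; rewrite /powR gt_eqF. Qed.

Lemma bernoulli_ineq (R : realType) (a : R) (m : nat) : 0 <= a ->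
  1 + m%:R * a <= (1 + a) ^+ m.
Proof.
move=> a0; elim: m => [|m IH]; first by rewrite mul0r addr0 expr0.
rewrite exprS; have := ler_wpM2l (addr_ge0 ler01 a0) IH.
have : 0 <= m%:R * a * a by rewrite !mulr_ge0.
rewrite -natr1; set M := m%:R; move=> h1 h2; apply: le_trans h2; nra.
Qed.

Section entropy_sum.
Context {R : realType}.
Variables (beta gamma delta Cbg Cd b theta kappa : R).
Hypotheses (hgamma : 0 < gamma) (hCbg : 0 < Cbg) (hCd : 0 < Cd) (hb : 0 < b).
Hypotheses (htheta0 : 0 < theta) (htheta1 : theta < 1).
Hypotheses (hkappa0 : 0 < kappa) (hkappa1 : kappa < 1) (hkappa2 : kappa < 2 * gamma).

Definition chain_sd (k : nat) : R := Cd * b `^ delta * theta ^+ k.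

Definition chain_mesh (k : nat) : R := (chain_sd k / (Cbg * b `^ beta)) `^ gamma^-1.

(* The index shift: the k-th net has to resolve the (k+1)-st increment. *)
Definition chain_level (k : nat) : R :=
  2 * Num.sqrt ((b / chain_mesh k.+1) `^ kappa / kappa).

Let alpha := kappa / (2 * gamma).

(** This is [Cd^(1 - alpha) Cbg^alpha b^(delta + kappa1) theta^(- alpha)] with the [kappa1] of the
    theorem. It is written through logarithms so that identities between powers become linear ones
    for [field]. *)
Let M := expR ((1 - alpha) * (ln Cd + delta * ln b) + kappa / 2 * ln b
  + alpha * (ln Cbg + beta * ln b) - alpha * ln theta).

Let alpha0 : 0 < alpha. Proof. by rewrite divr_gt0// mulr_gt0. Qed.

Let alpha1 : alpha < 1.
Proof. by rewrite ltr_pdivrMr ?mul1r// mulr_gt0. Qed.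

Let pb p : 0 < b `^ p. Proof. exact: powR_gt0. Qed.

Lemma chain_sd_gt0 k : 0 < chain_sd k.
Proof. by rewrite mulr_gt0 ?exprn_gt0// mulr_gt0. Qed.

Lemma chain_mesh_gt0 k : 0 < chain_mesh k.
Proof. by rewrite powR_gt0// divr_gt0 ?chain_sd_gt0// mulr_gt0. Qed.

Lemma chain_mesh_sd k : Cbg * b `^ beta * chain_mesh k `^ gamma = chain_sd k.
Proof.
have L0 : 0 < Cbg * b `^ beta by rewrite mulr_gt0.
rewrite /chain_mesh -powRrM mulVf ?gt_eqF//.
rewrite powRr1 ?divr_ge0 ?(ltW (chain_sd_gt0 k)) ?(ltW L0)//.
by rewrite mulrC divfK ?gt_eqF.
Qed.

Lemma chain_level_ge0 k : 0 <= chain_level k.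
Proof. by rewrite mulr_ge0// sqrtr_ge0. Qed.

Lemma chain_mesh_entropy k :
  (1 + b / chain_mesh k.+1) ^+ 2 <= expR (chain_level k ^+ 2 / 2).
Proof.
set x := b / _; have x0 : 0 <= x by rewrite divr_ge0 ?ltW ?chain_mesh_gt0.
(* The factor 2 in [chain_level] is fitted to the square: each of the two coordinates contributes
   [x^kappa / kappa] to the exponent. *)
have -> : chain_level k ^+ 2 / 2 = x `^ kappa / kappa *+ 2.
  rewrite /chain_level -/x exprMn sqr_sqrtr ?divr_ge0 ?powR_ge0 ?(ltW hkappa0)//.
  by rewrite -mulr_natr; field; rewrite gt_eqF.
rewrite -mulr_natl expRM_natl lerXn2r ?nnegrE ?addr_ge0 ?expR_ge0//.
exact: expR_ge_1Dx_powR (ltW _) _.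
Qed.

(** The deviation decays like [theta^k] and the level grows like [theta^(- alpha (k + 1))], so the
    product is geometric with ratio [theta^(1 - alpha)]. The shift by one leaves the factor
    [theta^(- alpha)] in [M]. *)
Let chain_term k : chain_sd k * chain_level k =
  2 / Num.sqrt kappa * M * (theta `^ (1 - alpha)) ^+ k.
Proof.
have sk : Num.sqrt kappa != 0 by rewrite gt_eqF// sqrtr_gt0.
have e0 j : chain_sd j = expR (ln Cd + delta * ln b + j%:R * ln theta).
  by rewrite /chain_sd powR_expR// !expRD lnK// expRM_natl lnK.
have eh : chain_mesh k.+1 = expR (gamma^-1 *
    (ln Cd + delta * ln b + k.+1%:R * ln theta - (ln Cbg + beta * ln b))).
  rewrite /chain_mesh powR_expR ?divr_gt0 ?chain_sd_gt0 ?mulr_gt0//; congr (expR (_ * _)).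
  by rewrite ln_div ?posrE ?chain_sd_gt0 ?mulr_gt0// e0 expRK lnM ?posrE// ln_powR.
have -> : chain_level k = 2 / Num.sqrt kappa * expR (kappa / 2 * (ln b - gamma^-1 *
    (ln Cd + delta * ln b + k.+1%:R * ln theta - (ln Cbg + beta * ln b)))).
  rewrite /chain_level sqrtrM ?powR_ge0// sqrtrV ?(ltW hkappa0)// mulrA mulrAC.
  congr (_ * _).
  rewrite -powR12_sqrt ?powR_ge0// -powRrM powR_expR ?divr_gt0 ?chain_mesh_gt0//.
  by rewrite ln_div ?posrE ?chain_mesh_gt0// eh expRK.
rewrite e0 mulrCA -!mulrA; congr (_ * (_ * _)).
rewrite powR_expR// -expRM_natl /M -!expRD; congr expR.
by rewrite -natr1 /alpha; field; rewrite gt_eqF.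
Qed.

(** The levels grow geometrically with ratio [theta^(- alpha) > 1], hence at least linearly by
    Bernoulli. This lets the chain end at the whole finite family. *)
Lemma chain_level_unbounded (x : R) : exists m, x <= chain_level m.
Proof.
pose c := 2 / Num.sqrt kappa * M / (Cd * b `^ delta).
have c0 : 0 < c by rewrite !mulr_gt0 ?invr_gt0 ?sqrtr_gt0 ?expR_gt0 ?mulr_gt0.
pose a := theta `^ (- alpha) - 1.
have a0 : 0 < a.
  rewrite subr_gt0 powR_expR// -[ltLHS]expR0 ltr_expR mulNr oppr_gt0.
  by rewrite pmulr_rlt0// ln_lt0// htheta0.
have cm m : chain_level m = c * (1 + a) ^+ m.
  have sd0 : chain_sd m != 0 by rewrite gt_eqF// chain_sd_gt0.
  apply: (mulfI sd0); rewrite chain_term /a subrKC.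
  have -> : theta `^ (1 - alpha) = theta * theta `^ (- alpha).
    by rewrite powRD ?(gt_eqF htheta0) ?implybT// powRr1// ltW.
  by rewrite exprMn /chain_sd /c; field; rewrite !gt_eqF ?sqrtr_gt0.
exists (Num.trunc (x / (c * a))).+1; set m := _.+1.
have ca0 : 0 < c * a by rewrite mulr_gt0.
have xm : x < m%:R * (c * a) by rewrite -ltr_pdivrMr// truncnS_gt.
rewrite cm; apply: le_trans (ltW xm) _; rewrite mulrCA ler_pM2l//.
by apply: le_trans (bernoulli_ineq _ _ m (ltW a0)); rewrite lerDr.
Qed.

(** The second summand of the exponent in the theorem, divided by [lambda]. *)
Definition entropy_bound : R :=
  let kappa1 := kappa / 2 * (1 + beta / gamma - delta / gamma) in
  let C2 := 2 `^ ((1 - kappa) / 2) / (1 - kappa / (2 * gamma))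
            * Cd `^ (1 - kappa / (2 * gamma)) * Cbg `^ (kappa / (2 * gamma)) in
  2 / (1 - theta) * b `^ (delta + kappa1)
    * (C2 / (theta `^ (kappa / (2 * gamma)) * Num.sqrt kappa)).

Lemma chain_sum_le (n : nat) :
  \sum_(k < n) chain_sd k * chain_level k <= entropy_bound.
Proof.
rewrite /entropy_bound; set kappa1 := _ * (_ + _); set C2 := _ * Cbg `^ _.
cbv zeta; set q := theta `^ (1 - alpha).
have s0 : 0 < Num.sqrt kappa by rewrite sqrtr_gt0.
(* Weighted arithmetic-geometric inequality: [theta^(1 - alpha) <= (1 - alpha) theta + alpha]. It
   produces the denominators [1 - theta] and [1 - kappa / (2 gamma)] of the bound. *)
have qle : (1 - theta) * (1 - alpha) <= 1 - q.
  have := @expR_subconvex R 1 (fun=> 1 - alpha) (fun=> ln theta).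
  rewrite !big_ord1 lnK// -powR_expR// -/q => H.
  have {H} : q <= (1 - alpha) * theta + (1 - (1 - alpha)).
    by apply: H => [_|]; rewrite ?subr_ge0 ?(ltW alpha1)// gerBl ltW.
  lra.
have t1 : 0 < 1 - theta by rewrite subr_gt0.
have a1 : 0 < 1 - alpha by rewrite subr_gt0.
have q1 : q < 1 by rewrite -subr_gt0 (lt_le_trans _ qle)// mulr_gt0.
under eq_bigr do rewrite chain_term.
rewrite -mulr_sumr -/q.
apply: (@le_trans _ _ (2 / Num.sqrt kappa * M * (1 - q)^-1)).
  rewrite ler_pM2l ?sum_geometric_le ?powR_ge0//.
  by rewrite mulr_gt0 ?expR_gt0// divr_gt0.
have two1 : 1 <= 2 `^ ((1 - kappa) / 2) :> R.
  rewrite powR_expR// -[leLHS]expR0 ler_expR mulr_ge0 ?divr_ge0 ?subr_ge0 ?(ltW hkappa1)//.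
  by rewrite ln_ge0// ler1n.
have -> : 2 / (1 - theta) * b `^ (delta + kappa1)
    * (C2 / (theta `^ (kappa / (2 * gamma)) * Num.sqrt kappa)) =
    2 / Num.sqrt kappa * M * (2 `^ ((1 - kappa) / 2) / ((1 - theta) * (1 - alpha))).
  have -> : M = b `^ (delta + kappa1) * (Cd `^ (1 - alpha) * Cbg `^ alpha / theta `^ alpha).
    rewrite -powRN !powR_expR// -!expRD /M; congr expR.
    by rewrite /kappa1 /alpha; field; rewrite gt_eqF.
  have T0 : theta `^ alpha != 0 by rewrite gt_eqF// powR_gt0.
  rewrite /C2 -/alpha; field.
  by rewrite T0 !gt_eqF.
rewrite ler_pM2l; last by rewrite mulr_gt0 ?expR_gt0// divr_gt0.
rewrite -[leLHS]mul1r ler_pM ?invr_ge0 ?subr_ge0 ?(ltW q1)//.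
by rewrite lef_pV2 ?posrE ?subr_gt0// mulr_gt0.
Qed.

End entropy_sum.

(** * The bound for finite families of the process *)

Section finite_families.
Context {R : realType} {d : measure_display} {Omega : measurableType d}.
Variable P : probability Omega R.
Variable X : R * R -> Omega -> R.
Hypothesis D1g : centered_gaussian_process P X.

Lemma process_exp_norm (t : R * R) (sigma : R) : Tset t ->
  (Ex P (fun w => ((X t w) ^+ 2)%R) < +oo)%E ->
  Num.sqrt (fine (Ex P (fun w => ((X t w) ^+ 2)%R))) <= sigma ->
  exp_norm_bounded P (X t) sigma.
Proof.
move=> tT fin le; have := D1g 1%N (fun=> t) (fun=> 1) (fun=> tT).
have -> : (fun w => \sum_(i < 1) 1 * X t w) = X t.
  by apply/funext => w; rewrite big_ord1 mul1r.
by move=> g; split; [exact: g.1|exact: centered_gaussian_exp_norm].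
Qed.

Lemma process_increment_exp_norm (t s : R * R) (sigma : R) : Tset t -> Tset s ->
  (Ex P (fun w => ((X t w - X s w) ^+ 2)%R) < +oo)%E ->
  Num.sqrt (fine (Ex P (fun w => ((X t w - X s w) ^+ 2)%R))) <= sigma ->
  exp_norm_bounded P (fun w => X t w - X s w) sigma.
Proof.
move=> tT sT fin le.
have := D1g 2%N (fun i => if i == ord0 then t else s)
  (fun i => if i == ord0 then 1 else -1).
have -> : (fun w => \sum_(i < 2) (if i == ord0 then 1 else -1) *
    X (if i == ord0 then t else s) w) = (fun w => X t w - X s w).
  by apply/funext => w; rewrite big_ord_recl big_ord1/= mul1r mulN1r.
move=> g; have {}g : centered_gaussian P (fun w => X t w - X s w).
  by apply: g => i; case: ifP.
by split; [exact: g.1|exact: centered_gaussian_exp_norm].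
Qed.

Variables (beta gamma delta Cbg Cd : R).
Hypotheses (hbeta : 0 < beta) (hgamma : 0 < gamma) (hdelta : 0 < delta).
Hypotheses (hCbg : 0 < Cbg) (hCd : 0 < Cd).
Hypothesis D2 : forall t s, Tset t -> Tset s ->
  (Ex P (fun w => ((X t w - X s w) ^+ 2)%R) < +oo)%E /\
  Num.sqrt (fine (Ex P (fun w => ((X t w - X s w) ^+ 2)%R)))
    <= Cbg * (Num.max t.1 s.1) `^ beta * (mT t s) `^ gamma.
Hypothesis D3 : forall t, Tset t ->
  (Ex P (fun w => ((X t w) ^+ 2)%R) < +oo)%E /\
  Num.sqrt (fine (Ex P (fun w => ((X t w) ^+ 2)%R))) <= Cd * t.1 `^ delta.

Lemma finite_family_exp_bound (b theta lambda kappa : R) (F : seq (R * R)) :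
  0 < b -> 0 < theta -> theta < 1 -> 0 < lambda ->
  0 < kappa -> kappa < 1 -> kappa < 2 * gamma ->
  (forall t, t \in F -> Tset t /\ t.1 <= b) ->
  exists G : Omega -> R, [/\ measurable_fun setT G, forall w, 0 <= G w,
    (\int[P]_w (G w)%:E <=
      (2 * expR ((lambda * (Cd * b `^ delta / (1 - theta))) ^+ 2 / 2))%:E)%E &
    forall t w, t \in F -> expR (lambda * `|X t w|) <=
      expR (lambda * entropy_bound beta gamma delta Cbg Cd b theta kappa) * G w].
Proof.
move=> b0 th0 th1 l0 k0 k1 k2 FT.
pose eps := chain_sd delta Cd b theta.
pose h := chain_mesh beta gamma delta Cbg Cd b theta.
pose s := chain_level beta gamma delta Cbg Cd b theta kappa.
have eps0 k : 0 < eps k by exact: chain_sd_gt0.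
have s0 k : 0 <= s k by exact: chain_level_ge0.
have h0 k : 0 < h k by exact: chain_mesh_gt0.
(* The depth [m] is where the entropy allowance exceeds the cardinality of [F], so that [F] itself
   serves as the last net. *)
have [m sm] : exists m, (size F)%:R <= s m by exact: chain_level_unbounded.
have netP k : exists Np : seq (R * R) * (R * R -> R * R), [/\ {subset Np.1 <= F},
    (size Np.1)%:R <= (1 + b / h k.+1) ^+ 2 &
    forall t, t \in F -> Np.2 t \in Np.1 /\ mT t (Np.2 t) <= h k.+1].
  have [N [p H]] := grid_net _ _ _ F (ltW b0) (h0 k.+1) FT.
  by exists (N, p).
have [Np {}netP] := choice netP.
pose Fk k := if (k < m)%N then (Np k).1 else F.
have FkF k : {subset Fk k <= F}.
  move=> t; rewrite /Fk; case: ifP => [_|//]; have [sN _ _] := netP k; exact: sN.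
have [|||t tF|k t km tF|G [mG G0 IG GF]] := @chaining_exp_bound _ _ _ P _ X m Fk
  (fun k => (Np k).2) eps s (Cd * b `^ delta / (1 - theta)) lambda _ l0 eps0 s0.
- by rewrite divr_gt0 ?subr_gt0// mulr_gt0 ?powR_gt0.
- rewrite /eps /chain_sd -mulr_sumr ler_pM2l ?mulr_gt0 ?powR_gt0//.
  exact: sum_geometric_le (ltW _) _.
- move=> k km; rewrite /Fk; case: ltnP => [_|mk].
    by have [_ sN _] := netP k; apply: le_trans sN _; exact: chain_mesh_entropy.
  have -> : k = m by apply/eqP; rewrite eqn_leq km.
  (* Here [s <= 1 + s^2/2 <= exp (s^2/2)], the first inequality from [(s - 1)^2 >= 0]. *)
  apply: le_trans sm _; apply: le_trans _ (expR_ge1Dx _).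
  by have := sqr_ge0 (s m - 1); rewrite sqrrB1; lra.
- have [tT tb] := FT _ (FkF _ _ tF); have [fin le] := D3 _ tT.
  apply: process_exp_norm => //; apply: le_trans le _.
  rewrite /eps /chain_sd expr0 mulr1 ler_pM2l//.
  rewrite ge0_ler_powR ?nnegrE ?(ltW hdelta) ?(ltW b0)//.
  by case: tT => t20 t21; exact: le_trans t21.
- have tF' := FkF _ _ tF; have [_ _ /(_ _ tF')[pN pd]] := netP k.
  rewrite /Fk km; split=> //.
  have [tT tb] := FT _ tF'; have [sN _ _] := netP k.
  have [pT pb] := FT _ (sN _ pN); have [fin le] := D2 _ _ tT pT.
  apply: process_increment_exp_norm => //; apply: le_trans le _.
  have -> : eps k.+1 = Cbg * b `^ beta * h k.+1 `^ gamma by rewrite /eps /h chain_mesh_sd.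
  have t10 : 0 <= t.1 by case: tT => t20 t21; exact: le_trans t21.
  have m0 : 0 <= mT t ((Np k).2 t) by rewrite /mT le_max normr_ge0.
  rewrite ler_pM ?mulr_ge0 ?powR_ge0 ?(ltW hCbg)//.
    rewrite ler_pM2l// ge0_ler_powR ?nnegrE ?(ltW hbeta) ?(ltW b0) ?le_max ?t10//.
    by rewrite ge_max tb.
  by rewrite ge0_ler_powR ?nnegrE ?(ltW hgamma) ?(ltW (h0 _)).
- exists G; split=> // t w tF; apply: le_trans (GF t w _) _; first by rewrite /Fk ltnn.
  by rewrite ler_wpM2r// ler_expR ler_pM2l//; exact: chain_sum_le.
Qed.

End finite_families.

(** * From finite families to the supremum *)

(** The integral of a nonnegative function is a supremum over the simple functions below it, and
    this is monotone for arbitrary functions. It serves for the uncountable supremum. *)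
Lemma ge0_le_integral_nonmeasurable {d : measure_display} {T : measurableType d}
  {R : realType} (mu : {measure set T -> \bar R}) (f g : T -> \bar R) :
  (forall x, (0 <= f x)%E) -> (forall x, (f x <= g x)%E) ->
  (\int[mu]_x f x <= \int[mu]_x g x)%E.
Proof.
move=> f0 fg; rewrite !ge0_integralTE//; last by move=> x; exact: le_trans (fg x).
apply: ereal_sup_le => _ [h hf <-]; exists h => // x.
exact: le_trans (hf x) (fg x).
Qed.

(** Adding [+oo] on [N] to [g] dominates [f] everywhere and leaves the integral of [g] unchanged. *)
Lemma ge0_integral_le_off_null {d : measure_display} {T : measurableType d}
  {R : realType} (P : probability T R) (N : set T) (f g : T -> \bar R) :
  measurable N -> P N = 0%E -> measurable_fun setT g ->
  (forall x, (0 <= f x)%E) -> (forall x, (0 <= g x)%E) ->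
  (forall x, ~ N x -> (f x <= g x)%E) ->
  (\int[P]_x f x <= \int[P]_x g x)%E.
Proof.
move=> mN PN mg f0 g0 fg.
have mI : measurable_fun setT (fun x => (\1_N x : R)%:E).
  by apply/measurable_EFinP; exact: measurable_indic.
apply: (@le_trans _ _ (\int[P]_x (g x + +oo * (\1_N x)%:E))%E).
  apply: ge0_le_integral_nonmeasurable => // x; rewrite indicE.
  case: (boolP (x \in N)) => [_|/negP xN] /=.
    by rewrite mule1 addey ?leey// -ltNye (lt_le_trans _ (g0 x)).
  by rewrite mule0 adde0 fg// => /mem_set.
rewrite ge0_integralD//; last exact: emeasurable_funM.
rewrite ge0_integralZl//.
have -> : (\int[P]_x (\1_N x : R)%:E = 0)%E by rewrite integral_indic// setIT.
by rewrite mule0 adde0.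
Qed.

Lemma limn_einf_ge_near {R : realType} (u : nat -> \bar R) (x : \bar R) (n0 : nat) :
  (forall n, (n0 <= n)%N -> (x <= u n)%E) -> (x <= limn_einf u)%E.
Proof.
move=> xu; rewrite limn_einf_lim; apply: lime_ge; first exact: is_cvg_einfs.
exists n0 => // n /= n0n; apply: le_ereal_inf_tmp => _ [k /= nk <-].
by apply: xu; exact: leq_trans nk.
Qed.

Lemma limn_einf_le_all {R : realType} (u : nat -> \bar R) (x : \bar R) :
  (forall n, (u n <= x)%E) -> (limn_einf u <= x)%E.
Proof.
move=> ux; rewrite limn_einf_lim; apply: lime_le; first exact: is_cvg_einfs.
apply: nearW => n; apply: le_trans (ux n); apply: ereal_inf_lbound.
by exists n => /=.
Qed.

Lemma measurable_fun_limn_einf {d : measure_display} {T : measurableType d}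
  {R : realType} (f : nat -> T -> \bar R) :
  (forall n, measurable_fun setT (f n)) ->
  measurable_fun setT (fun x => limn_einf (f ^~ x)).
Proof.
move=> mf; rewrite /limn_einf; apply: measurableT_comp => //.
by apply: measurable_fun_limn_esup => n; exact: measurableT_comp.
Qed.

(* Passing from finite subfamilies to the countable family by Fatou's lemma
   needs no measurability of the supremum. *)
Lemma countable_envelope {d : measure_display} {Omega : measurableType d}
  {R : realType} (P : probability Omega R) (T : eqType) (Z : T -> Omega -> R)
  (S : set T) (c K : R) : 0 <= c -> 0 <= K -> countable S ->
  (forall F : seq T, (forall t, t \in F -> S t) ->
    exists G : Omega -> R, [/\ measurable_fun setT G, forall w, 0 <= G w,
      (\int[P]_w (G w)%:E <= K%:E)%E & forall t w, t \in F -> Z t w <= c * G w]) ->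
  exists H : Omega -> \bar R, [/\ measurable_fun setT H, forall w, (0 <= H w)%E,
    (\int[P]_w H w <= (c * K)%:E)%E & forall t w, S t -> ((Z t w)%:E <= H w)%E].
Proof.
move=> c0 K0 /pfcard_geP[->|[f]] HF.
  exists (cst 0%E); split=> //; rewrite integral0 lee_fin.
  exact: mulr_ge0.
have GP n : exists G : Omega -> R, [/\ measurable_fun setT G, forall w, 0 <= G w,
    (\int[P]_w (G w)%:E <= K%:E)%E &
    forall k w, (k < n)%N -> Z (f k) w <= c * G w].
  have [t /mapP[k _ ->]|G [mG G0 IG ZG]] := HF [seq f k | k <- iota 0 n].
    exact: funS.
  exists G; split=> // k w kn; apply: ZG; apply: map_f.
  by rewrite mem_iota.
have [G {}GP] := choice GP.
have mcG n : measurable_fun setT (fun w => (c * G n w)%:E).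
  by apply/measurable_EFinP; apply: measurable_funM => //; have [] := GP n.
have cG0 n w : (0 <= (c * G n w)%:E)%E.
  by rewrite lee_fin mulr_ge0//; have [_ G0 _ _] := GP n.
(* The k-th member of the enumeration is dominated by [c * G n] for every [n > k], hence by the
   lower limit. *)
exists (fun w => limn_einf (fun n => (c * G n w)%:E)); split.
- exact: measurable_fun_limn_einf.
- by move=> w; apply: (@limn_einf_ge_near _ _ _ 0%N).
- apply: le_trans (fatou _ measurableT mcG (fun n w _ => cG0 n w)) _.
  apply: limn_einf_le_all => n; have [mG G0 IG _] := GP n.
  under eq_integral do rewrite EFinM.
  rewrite ge0_integralZl//; first last.
  + by move=> w _; rewrite lee_fin.
  + exact/measurable_EFinP.
  by rewrite EFinM lee_wpmul2l// lee_fin.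
- move=> t w St; have [k _ <-] := 'surj_f St.
  apply: (@limn_einf_ge_near _ _ _ k.+1) => n kn; rewrite lee_fin.
  by have [_ _ _ ->] := GP n.
Qed.

(** For finite [h = r], the number [ln r / lambda] bounds every [f i]. A point of [A] makes [h]
    positive, so the logarithm is available. *)
Lemma expeR_ereal_sup_le {R : realType} (I : Type) (A : set I) (f : I -> R)
    (lambda : R) (h : \bar R) : 0 < lambda -> A !=set0 ->
  (forall i, A i -> ((expR (lambda * f i))%:E <= h)%E) ->
  (expeR (lambda%:E * ereal_sup [set (f i)%:E | i in A]) <= h)%E.
Proof.
move=> l0 [i0 Ai0]; case: h => [r| |] fh; last 2 first.
- by rewrite leey.
- by have := fh _ Ai0; rewrite leeNy_eq.
have r0 : 0 < r by have := fh _ Ai0; rewrite lee_fin; apply: lt_le_trans; exact: expR_gt0.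
have -> : r%:E = expeR (ln r)%:E by rewrite /= lnK.
rewrite lee_expeR; have -> : (ln r)%:E = (lambda%:E * (ln r / lambda)%:E)%E.
  by rewrite -EFinM mulrC divfK ?gt_eqF.
apply: lee_wpmul2l; first by rewrite lee_fin ltW.
apply: ge_ereal_sup => _ [i Ai <-]; rewrite lee_fin ler_pdivlMr// mulrC.
by rewrite -ler_expR lnK ?posrE// -lee_fin fh.
Qed.

Section separable_supremum.
Context {R : realType} {d : measure_display} {Omega : measurableType d}.
Variable P : probability Omega R.

(* A point [t] with [t.1 = b] may only be approximated from outside [Tab a b],
   whence the countable family on [t.1 <= b'] for some [b' > b]. *)
Lemma separable_sup_exp_le (X : R * R -> Omega -> R) (a b b' lambda c K : R) :
  separable_process P X -> 0 <= a -> a < b -> b < b' -> 0 < lambda ->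
  0 <= c -> 0 <= K ->
  (forall F : seq (R * R), (forall t, t \in F -> Tset t /\ t.1 <= b') ->
    exists G : Omega -> R, [/\ measurable_fun setT G, forall w, 0 <= G w,
      (\int[P]_w (G w)%:E <= K%:E)%E &
      forall t w, t \in F -> expR (lambda * `|X t w|) <= c * G w]) ->
  (\int[P]_w expeR (lambda%:E * ereal_sup [set (`|X t w|)%:E | t in Tab a b])
    <= (c * K)%:E)%E.
Proof.
move=> [S [cS [ST [N [mN [PN sep]]]]]] a0 ab bb' l0 c0 K0 HF.
have [H [mH H0 IH XH]] := @countable_envelope _ _ _ P _
  (fun t w => expR (lambda * `|X t w|)) (S `&` [set t | t.1 <= b']) c K c0 K0
  (sub_countable (@subset_card_le _ _ _ (@subIsetl _ _ _)) cS)
  (fun F FS => HF F (fun t tF => conj (ST _ (FS _ tF).1) (FS _ tF).2)).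
apply: le_trans IH.
apply: (@ge0_integral_le_off_null _ _ _ P N) => //.
  by move=> w; exact: expeR_ge0.
move=> w Nw; apply: expeR_ereal_sup_le => //.
  by exists (a, 0); split; split => //=; exact: ltW.
move=> t [tT [_ tb]]; have [u [uS [ut Xut]]] := sep w Nw t tT.
(* Since [t.1 <= b], approximants closer to [t] than [b' - b] have first coordinate at most [b'] and
   belong to the countable family. *)
have uH : \forall n \near \oo, ((expR (lambda * `|X (u n) w|))%:E <= H w)%E.
  near=> n; apply: XH; split; first exact: uS.
  have : mT (u n) t < b' - b.
    near: n; have := cvgr_lt _ ut; apply.
    by rewrite subr_gt0.
  rewrite /mT gt_max => /andP[+ _]; rewrite /= ltr_norml => /andP[_].
  lra.
have cexp : (fun n => expR (lambda * `|X (u n) w|)) @ \oo --> expR (lambda * `|X t w|).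
  apply: continuous_cvg; first exact: continuous_expR.
  by apply: cvgMr; exact: cvg_norm.
case: (H w) uH => [r| |] uH.
- rewrite lee_fin -(cvg_lim (@Rhausdorff R) cexp).
  apply: limr_le; first by apply/cvg_ex; eexists; exact: cexp.
  by apply: filterS uH => n; rewrite lee_fin.
- by rewrite leey.
- by have /filter_ex[n] := uH; rewrite leeNy_eq.
Unshelve. all: by end_near. Qed.

End separable_supremum.

(** * Removing the perturbation and conclusion *)

Lemma powR_gt0_shift_cvg {R : realType} (x p : R) : 0 < x ->
  (x + e) `^ p @[e --> 0^'+] --> x `^ p.
Proof.
move=> x0; apply: cvg_at_right_filter.
have cx : {for x, continuous (@powR R ^~ p)}.
  apply: differentiable_continuous; apply/derivable1_diffP.
  by apply: derivable_powR; rewrite in_itv/= andbT.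
have cD : x + e @[e --> 0] --> x.
  by rewrite -[X in _ --> X]addr0; apply: cvgD; [exact: cvg_cst|exact: cvg_id].
exact: cvg_comp cD cx.
Qed.

Lemma powR_ge0_shift_cvg {R : realType} (x p : R) : 0 < p -> 0 <= x ->
  (x + e) `^ p @[e --> 0^'+] --> x `^ p.
Proof.
move=> p0; rewrite le_eqVlt => /predU1P[<-|]; last exact: powR_gt0_shift_cvg.
under eq_fun do rewrite add0r.
by rewrite powR0 ?gt_eqF//; exact: powR_cvg0.
Qed.

Theorem theorem3p2 (R : realType) (d : measure_display) (Omega : measurableType d)
  (P : probability Omega R) (X : R * R -> Omega -> R)
  (beta gamma delta Cbg Cd : R)
  (hbeta : 0 < beta) (hgamma : 0 < gamma) (hdelta : 0 < delta)
  (* (D1) *)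
  (D1g : centered_gaussian_process P X)
  (D1s : separable_process P X)
  (* (D2) *)
  (D2 : forall t s, Tset t -> Tset s ->
     (Ex P (fun w => ((X t w - X s w) ^+ 2)%R) < +oo)%E /\
     Num.sqrt (fine (Ex P (fun w => ((X t w - X s w) ^+ 2)%R)))
       <= Cbg * (Num.max t.1 s.1) `^ beta * (mT t s) `^ gamma)
  (* (D3) *)
  (D3 : forall t, Tset t ->
     (Ex P (fun w => ((X t w) ^+ 2)%R) < +oo)%E /\
     Num.sqrt (fine (Ex P (fun w => ((X t w) ^+ 2)%R))) <= Cd * t.1 `^ delta)
  (a b : R) (ha : 0 <= a) (hab : a < b)
  (theta lambda kappa : R)
  (htheta0 : 0 < theta) (htheta1 : theta < 1) (hlambda : 0 < lambda)
  (hkappa0 : 0 < kappa) (hkappa1 : kappa < 1) (hkappa2 : kappa < 2 * gamma) :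
  let kappa1 := kappa / 2 * (1 + beta / gamma - delta / gamma) in
  let C2 := 2 `^ ((1 - kappa) / 2) / (1 - kappa / (2 * gamma))
            * Cd `^ (1 - kappa / (2 * gamma)) * Cbg `^ (kappa / (2 * gamma)) in
  let Qt := expR (lambda ^+ 2 * (b `^ delta * Cd) ^+ 2 / (2 * (1 - theta) ^+ 2)
              + 2 * lambda / (1 - theta) * b `^ (delta + kappa1)
                * (C2 / (theta `^ (kappa / (2 * gamma)) * Num.sqrt kappa))) in
  (\int[P]_w expeR (lambda%:E *
       ereal_sup [set (`|X t w|)%:E | t in Tab a b]) <= (2 * Qt)%:E)%E.
Proof.
have b0 : 0 < b by exact: le_lt_trans hab.
(* Both constants are shown nonnegative by evaluating the conditions at points where the powers
   equal 1. *)
have Cd0 : 0 <= Cd.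
  have [|_] := D3 (1, 0); first by rewrite /Tset/=.
  by rewrite /= powR1 mulr1; apply: le_trans; exact: sqrtr_ge0.
have Cbg0 : 0 <= Cbg.
  have [||_] := D2 (1, 0) (0, 0); try by rewrite /Tset/=.
  rewrite /mT /= !subr0 normr1 normr0 !max_l// !powR1 !mulr1.
  by apply: le_trans; exact: sqrtr_ge0.
have alpha0 : 0 < kappa / (2 * gamma) by rewrite divr_gt0// mulr_gt0.
have alpha1 : 0 < 1 - kappa / (2 * gamma).
  by rewrite subr_gt0 ltr_pdivrMr ?mul1r// mulr_gt0.
set I := (\int[P]_w _)%E.
pose V x y := 2 * expR ((lambda * (x * y `^ delta / (1 - theta))) ^+ 2 / 2).
(* The bound for the perturbed data; the second and third conditions persist when their constants
   increase. *)
pose W e := expR (lambda *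
    entropy_bound beta gamma delta (Cbg + e) (Cd + e) (b + e) theta kappa) *
  V (Cd + e) (b + e).
have IW e : 0 < e -> (I <= (W e)%:E)%E.
  move=> e0; apply: (@separable_sup_exp_le _ _ _ P X a b (b + e)) => //.
  - by rewrite ltrDl.
  - by rewrite mulr_ge0 ?expR_ge0.
  move=> F FT.
  have Cd0' : 0 < Cd + e by rewrite ltr_wpDl.
  have Cbg0' : 0 < Cbg + e by rewrite ltr_wpDl.
  have be0 : 0 < b + e by rewrite addr_gt0.
  apply: (@finite_family_exp_bound _ _ _ P X D1g beta gamma delta (Cbg + e) (Cd + e)) => //.
  - move=> t s tT sT; have [fin le] := D2 _ _ tT sT; split=> //.
    apply: le_trans le _; rewrite ler_wpM2r ?powR_ge0// ler_wpM2r ?powR_ge0//.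
    by rewrite lerDl ltW.
  - move=> t tT; have [fin le] := D3 _ tT; split=> //.
    by apply: le_trans le _; rewrite ler_wpM2r ?powR_ge0// lerDl ltW.
have cW : W e @[e --> 0^'+] -->
    expR (lambda * entropy_bound beta gamma delta Cbg Cd b theta kappa) * V Cd b.
  apply: cvgM.
    apply: continuous_cvg; first exact: continuous_expR.
    apply: cvgMr; rewrite /entropy_bound.
    apply: cvgM; first by apply: cvgMr; exact: powR_gt0_shift_cvg.
    (* [Cbg] and [Cd] may be 0, but their exponents [alpha = kappa / (2 gamma)] and [1 - alpha] are
       positive, so the powers are right-continuous there too. *)
    apply: cvgMl; apply: cvgM; last exact: powR_ge0_shift_cvg.
    by apply: cvgMr; exact: powR_ge0_shift_cvg.
  apply: cvgMr; apply: continuous_cvg; first exact: continuous_expR.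
  apply: cvgMl; rewrite expr2; under eq_fun do rewrite expr2.
  have cL : lambda * ((Cd + e) * (b + e) `^ delta / (1 - theta)) @[e --> 0^'+] -->
      lambda * (Cd * b `^ delta / (1 - theta)).
    apply: cvgMr; apply: cvgMl; apply: cvgM; last exact: powR_gt0_shift_cvg.
    have := @powR_ge0_shift_cvg R Cd 1 ltr01 Cd0; rewrite powRr1//.
    apply: cvg_trans; apply: near_eq_cvg; near=> e.
    by rewrite powRr1// addr_ge0.
  exact: cvgM.
have IW0 : (I <= (expR (lambda * entropy_bound beta gamma delta Cbg Cd b theta kappa)
    * V Cd b)%:E)%E.
  case: I IW => [r| |] IW; last 2 first.
  - by have := IW 1 ltr01; rewrite leye_eq.
  - exact: leNye.
  rewrite lee_fin -(cvg_lim (@Rhausdorff R) cW).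
  apply: limr_ge; first by apply/cvg_ex; eexists; exact: cW.
  by near=> e; rewrite -lee_fin; apply: IW.
cbv zeta; apply: le_trans IW0 _; rewrite lee_fin /V mulrCA -expRD.
(* The limiting exponent coincides with that of [Qt], so only an identity remains. *)
rewrite ler_pM2l// ler_expR le_eqVlt; apply/orP; left; apply/eqP.
have t1 : 1 - theta != 0 by rewrite gt_eqF// subr_gt0.
rewrite addrC /entropy_bound; congr (_ + _); first by field.
by rewrite !mulrA [lambda * 2]mulrC.
Unshelve. all: by end_near. Qed.
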